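(* (Second order by differentiation of Vibrato, one-dimensional case.) Let $\Theta\subset\mathbb{R}$ be a parameter set and let $b,\sigma:\Theta\times\mathbb{R}\to\mathbb{R}$ be continuous, locally Lipschitz in the space variable and with linear growth, both uniformly in $\theta\in\Theta$. Let $X$ be the strong solution on $[0,T]$ of $dX_t=b(\theta,X_t)\,dt+\sigma(\theta,X_t)\,dW_t$, where the initial value $X_0$ may also depend on $\theta$ and $W$ is a one-dimensional standard Brownian motion. Let $\bar X^n_0,\dots,\bar X^n_n$ be its Euler scheme with $n$ steps of constant size $h=T/n$, and put $$\mu=\mu(\theta)=\bar X^n_{n-1}(\theta)+h\,b(\theta,\bar X^n_{n-1}(\theta)),\qquad s=s(\theta)=\sqrt{h}\,\sigma(\theta,\bar X^n_{n-1}(\theta)).$$ Let $V:\mathbb{R}\to\mathbb{R}$ be a Borel function with $\mathbb{E}|V(\bar X^n_n(\theta))|<+\infty$. Then, under a standard domination or uniform integrability assumption allowing differentiation in $\theta$ and integration to be interchanged, $$\begin{aligned}\frac{\partial^2}{\partial\theta^2}\mathbb{E}[V(\bar X^n_n(\theta))]=\mathbb{E}\Bigg[&\frac{\partial^2\mu}{\partial\theta^2}\,\mathbb{E}_Z\!\left[V(\mu+sZ)\frac{Z}{s}\right]+\left(\frac{\partial\mu}{\partial\theta}\right)^2\mathbb{E}_Z\!\left[V(\mu+sZ)\frac{Z^2-1}{s^2}\right]\\&+\left(\frac{\partial s}{\partial\theta}\right)^2\mathbb{E}_Z\!\left[V(\mu+sZ)\frac{Z^4-5Z^2+2}{s^2}\right]+\frac{\partial^2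 s}{\partial\theta^2}\,\mathbb{E}_Z\!\left[V(\mu+sZ)\frac{Z^2-1}{s}\right]\\&+2\,\frac{\partial\mu}{\partial\theta}\frac{\partial s}{\partial\theta}\,\mathbb{E}_Z\!\left[V(\mu+sZ)\frac{Z^3-3Z}{s^2}\right]\Bigg].\end{aligned}$$
   Context: The Euler scheme is defined by $\bar X^n_0=X_0$ and $\bar X^n_k=\bar X^n_{k-1}+b(\theta,\bar X^n_{k-1})h+\sigma(\theta,\bar X^n_{k-1})\sqrt{h}\,Z_k$ for $k=1,\dots,n$, where $Z_1,\dots,Z_n$ are independent $\mathcal{N}(0,1)$ variables ($\sqrt h\,Z_k$ is the increment of $W$ over the $k$-th step). Thus $\bar X^n_n=\mu+sZ_n$, and $\mu,s$ depend only on $\theta$ and $Z_1,\dots,Z_{n-1}$. The derivatives of $\mu$ and $s$ are pathwise derivatives in $\theta$ for fixed $Z_1,\dots,Z_{n-1}$. The inner expectation $\mathbb{E}_Z$ is over $Z\sim\mathcal{N}(0,1)$ independent of $Z_1,\dots,Z_{n-1}$, with $\mu$ and $s$ held fixed; the outer expectation is over $Z_1,\dots,Z_{n-1}$. The derivatives and quotients appearing in the formula are understood to make sense. *)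

(* Defs.v *)
From HB Require Import structures.
From mathcomp Require Import all_boot all_order all_algebra.
From mathcomp Require Import all_classical all_reals all_analysis.

Set Implicit Arguments.
Unset Strict Implicit.
Unset Printing Implicit Defensive.
Import Order.TTheory GRing.Theory Num.Theory.
Import numFieldNormedType.Exports.

Local Open Scope classical_set_scope.
Local Open Scope ring_scope.

Section coefficients.
Context {R : realType}.
Implicit Types (Theta : set R) (f : R -> R -> R).

Definition jointly_continuous Theta f :=
  {within Theta `*` [set: R], continuous (fun p : R * R => f p.1 p.2)}.

Definition locally_lipschitz_unif Theta f :=
  forall r : R, 0 < r -> exists L : R, forall theta x y, Theta theta ->
    `|x| <= r -> `|y| <= r -> `|f theta x - f theta y| <= L * `|x - y|.

Definition linear_growth_unif Theta f :=
  exists C : R, forall theta x, Theta theta -> `|f theta x| <= C * (1 + `|x|).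

End coefficients.

(* The product rule over every finite subfamily of (Z k)_(k in D). *)
Definition mutually_independent d (T : measurableType d) (R : realType)
    (P : probability T R) (D : set nat) (Z : nat -> T -> R) :=
  forall (J : seq nat) (A : nat -> set R),
    uniq J -> (forall k, k \in J -> D k) -> (forall k, measurable (A k)) ->
    P (\bigcap_(k in [set` J]) (Z k @^-1` A k)) =
    (\prod_(k <- J) P (Z k @^-1` A k))%E.

Section euler_scheme.
Context {R : realType}.
Variables (b sigma : R -> R -> R) (X0 : R -> R) (h : R).

(* z k is the value of the k-th Gaussian variable; the first one is z 1. *)
Fixpoint euler (theta : R) (z : nat -> R) (k : nat) : R :=
  if k is j.+1 then
    let x := euler theta z j in
    x + b theta x * h + sigma theta x * Num.sqrt h * z k
  else X0 theta.

Definition euler_mu (n : nat) (theta : R) (z : nat -> R) : R :=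
  let x := euler theta z n.-1 in x + h * b theta x.

Definition euler_s (n : nat) (theta : R) (z : nat -> R) : R :=
  Num.sqrt h * sigma theta (euler theta z n.-1).

End euler_scheme.

Definition derivable2 (R : realType) (f : R -> R) (x : R) :=
  (\forall t \near x, derivable f t 1) /\ derivable f^`()%classic x 1.

Section interchange.
Context d (T : measurableType d) (R : realType).
Variable m : {measure set T -> \bar R}.

(* Uniform integrability with respect to a measure that need not be finite:
   the usual constant threshold is replaced by an integrable function, so that
   a family dominated by an integrable function is uniformly integrable. *)
Definition unif_integrable (I : Type) (D : set I) (f : I -> T -> R) :=
  forall e : R, 0 < e -> exists2 g : T -> R,
    m.-integrable [set: T] (EFin \o g) &
    forall i, D i ->
      (\int[m]_(x in [set x | (g x < `|f i x|)%R]) (`|f i x|)%:E <= e%:E)%E.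

(* The assumption under which d/dt and the integral in x of f t x are
   interchanged at the point t. It follows from the domination of the
   derivative of f near t, see dominated_diff_quotients below. *)
Definition unif_integrable_diff_quotients (f : R -> T -> R) (t : R) :=
  exists2 delta : R, 0 < delta &
    unif_integrable [set e : R | 0 < `|e| < delta]
                    (fun e x => e^-1 * (f (t + e) x - f t x)).

(* Same thing for two successive derivatives, the second one at t only. *)
Definition unif_integrable_diff_quotients2 (f : R -> T -> R) (t : R) :=
  (\forall u \near t, unif_integrable_diff_quotients f u) /\
  unif_integrable_diff_quotients (fun u x => (f ^~ x)^`()%classic u) t.

Lemma dominated_unif_integrable (I : Type) (D : set I) (f : I -> T -> R)
    (g : T -> R) :
  m.-integrable [set: T] (EFin \o g) ->
  (forall i x, D i -> `|f i x| <= g x) -> unif_integrable D f.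
Proof.
move=> ig fg e e0; exists g => // i Di.
rewrite [X in integral _ X](_ : _ = set0) ?integral_set0 ?lee_fin 1?ltW//.
by apply/seteqP; split => // x /=; rewrite ltNge fg.
Qed.

Lemma dominated_diff_quotients (f : R -> T -> R) (t delta : R) (g : T -> R) :
  0 < delta -> m.-integrable [set: T] (EFin \o g) ->
  (forall u x, `|u - t| < delta ->
     derivable (f ^~ x) u 1 /\ `|(f ^~ x)^`()%classic u| <= g x) ->
  unif_integrable_diff_quotients f t.
Proof.
move=> d0 ig H; exists delta => //.
apply: (dominated_unif_integrable ig) => e x /= /andP[]; rewrite normr_gt0.
move=> e0 ed.
have mvt a c : a < c -> (forall u, u \in `[a, c] -> `|u - t| < delta) ->
    `|f c x - f a x| <= g x * (c - a).
  move=> ac near.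
  have [u uac ->] : exists2 u, u \in `]a, c[ &
      f c x - f a x = (f ^~ x)^`()%classic u * (c - a).
    apply: (@MVT _ (f ^~ x)) => //.
      move=> u uac; have [|du _] := H u x.
        by apply: near; exact: subset_itv_oo_cc.
      by rewrite derive1E; exact: derivableP.
    apply: derivable_within_continuous => u uac.
    by have [] := H u x (near _ uac).
  have [|_ gu] := H u x; first by apply: near; exact: subset_itv_oo_cc.
  by rewrite normrM (gtr0_norm (_ : 0 < c - a)) ?subr_gt0// ler_wpM2r// subr_ge0 ltW.
rewrite normrM normfV mulrC ler_pdivrMr ?normr_gt0//.
have [eneg|epos] : e < 0 \/ 0 < e by apply/orP; rewrite -neq_lt.
- rewrite distrC (le_trans (mvt _ _ _ _)) ?gtrDl//.
    move=> u; rewrite in_itv/= => /andP[h1 h2].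
    by rewrite (le_lt_trans _ ed)// ler_norml ltr0_norm// opprK lerBrDl h1 (le_trans (_ : _ <= 0)) ?subr_le0// oppr_ge0 ltW.
  by rewrite ltr0_norm// opprD addrA subrr add0r.
- rewrite (le_trans (mvt _ _ _ _)) ?ltrDl//.
    move=> u; rewrite in_itv/= => /andP[h1 h2].
    by rewrite (le_lt_trans _ ed)// (gtr0_norm epos) ger0_norm ?subr_ge0// lerBlDl.
  by rewrite gtr0_norm// addrC addKr.
Qed.

End interchange.

(* E_Z[f(Z)] for a standard Gaussian Z. *)
Definition gauss_expectation (R : realType) (f : R -> R) : R :=
  \int[normal_prob (0 : R) 1]_z f z.

(* The Gaussian expectations with the polynomial weights of the second order
   formula are expectations of integrable variables. *)
Definition gauss_weights_integrable (R : realType) (V : R -> R) (m s : R) :=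
  let int w := (normal_prob (0 : R) 1).-integrable [set: R]
                 (EFin \o (fun z : R => V (m + s * z) * w z)) in
  [/\ int (fun z => z), int (fun z => z ^+ 2 - 1),
      int (fun z => z ^+ 3 - 3 * z) &
      int (fun z => z ^+ 4 - 5 * z ^+ 2 + 2)].

(* Main.v *)
(* Given Z_1, ..., Z_(n-1), the last Euler step mu + s Z_n is Gaussian, so by
   independence and Fubini E[V(X_n)] is the expectation of the inner Gaussian
   expectation G = E_Z[V(mu + s Z)]. Written with the density p of N(mu, s^2),
   G is the Lebesgue integral of V p, where only the smooth density depends on
   theta, and with z = (x - mu) / s one has
     d(ln p) = dmu z / s + ds (z^2 - 1) / s.
   Differentiating V p twice under the Lebesgue integral and changing variables
   back to z gives the weights of the formula; G is then differentiated twice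
   under the outer expectation. Each of the four interchanges is Vitali's
   convergence theorem applied to difference quotients. *)
Require Import Defs.
From HB Require Import structures.
From mathcomp Require Import all_boot all_order all_algebra.
From mathcomp Require Import all_classical all_reals all_analysis.
From mathcomp Require Import measurable_realfun ring lra zify.

Import Order.TTheory GRing.Theory Num.Theory.
Import numFieldNormedType.Exports.

Local Open Scope classical_set_scope.
Local Open Scope ring_scope.

Set Implicit Arguments.
Unset Strict Implicit.
Unset Printing Implicit Defensive.

(** A pathwise derivative is a limit that exists only off a null set, so the differentiated
    integrand need not be measurable when [P] is not complete. The interchanges are therefore stated
    for functions that equal a measurable or integrable one almost everywhere. The inner
    interchanges are over the infinite Lebesgue measure and the outer ones over [P]; one Vitali
    theorem serves both, because truncation at an integrable threshold function takes the place of
    finiteness of the measure. Each interchange at a parameter relies on almost everywhere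
    differentiability at that parameter only, so no null set common to a neighbourhood is
    required. *)

(** * Integrals of functions equal almost everywhere *)

Section ae_integral.
Context d (T : measurableType d) (R : realType).
Variable m : {measure set T -> \bar R}.

Import HBNNSimple.
Local Open Scope ereal_scope.

(** The integral of a nonnegative function is a supremum over simple functions below it. Erasing
    such a function on the null set [N] keeps its integral and puts it below [g], so measurability
    of [f] and [g] never enters. *)
Lemma ge0_ae_le_integralT (f g : T -> \bar R) :
  (forall x, 0 <= f x) -> (forall x, 0 <= g x) ->
  {ae m, forall x, f x = g x} -> \int[m]_x f x <= \int[m]_x g x.
Proof.
move=> f0 g0 [N [mN N0 fgN]].
rewrite !ge0_integralTE//; apply: ge_ereal_sup => _ [h /= hf <-].
pose k := proj_nnsfun h (measurableC mN).
have -> : sintegral m h = sintegral m k.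
  rewrite -!integralT_nnsfun; apply: ge0_ae_eq_integral => //.
  - exact/measurable_EFinP.
  - exact/measurable_EFinP.
  - by move=> x _; rewrite lee_fin.
  - by move=> x _; rewrite lee_fin.
  exists N; split => // x /= hk; apply: contrapT => Nx; apply: hk => _.
  by rewrite mindicE mem_set// mulr1.
apply: ereal_sup_ubound; exists k => // x /=.
rewrite mindicE; have [Nx|Nx] := boolP (x \in ~` N).
  rewrite mulr1 (le_trans (hf x))//.
  move: Nx; rewrite inE /= => Nx.
  suff -> : f x = g x by [].
  by apply: contrapT => fg; apply: Nx; exact: fgN.
by rewrite mulr0.
Qed.

(* Unlike ae_eq_integral, this requires no measurability: pathwise derivatives
   need not be measurable when the measure is not complete. *)
Lemma ae_eq_integralT (f g : T -> \bar R) :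
  {ae m, forall x, f x = g x} -> \int[m]_x f x = \int[m]_x g x.
Proof.
move=> fg.
have gf : {ae m, forall x, g x = f x} by apply: filterS fg => x.
rewrite integralE [RHS]integralE; congr (_ - _); apply/eqP; rewrite eq_le;
  apply/andP; split; apply: ge0_ae_le_integralT => //.
- by apply: filterS fg => x; rewrite !funeposE => ->.
- by apply: filterS fg => x; rewrite !funeposE => ->.
- by apply: filterS fg => x; rewrite !funenegE => ->.
- by apply: filterS fg => x; rewrite !funenegE => ->.
Qed.

End ae_integral.

(** * Vitali's convergence theorem *)

Section vitali_convergence.
Context d (T : measurableType d) (R : realType).
Variable m : {measure set T -> \bar R}.

(** Measurability for the completion of [m], which is what almost everywhere limits retain. *)
Definition ae_measurable (f : T -> R) :=
  exists2 g : T -> R, measurable_fun [set: T] g & {ae m, forall x, f x = g x}.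

Definition ae_integrable (f : T -> R) :=
  exists2 g : T -> R, m.-integrable [set: T] (EFin \o g) &
    {ae m, forall x, f x = g x}.

Lemma integrable_ae_integrable (f : T -> R) :
  m.-integrable [set: T] (EFin \o f) -> ae_integrable f.
Proof. by move=> fi; exists f => //; exact: aeW. Qed.

Lemma measurable_ae_measurable (f : T -> R) :
  measurable_fun [set: T] f -> ae_measurable f.
Proof. by move=> fi; exists f => //; exact: aeW. Qed.

Lemma ae_integrable_measurable (f : T -> R) : ae_integrable f -> ae_measurable f.
Proof.
by move=> [g /measurable_int/measurable_EFinP mg fg]; exists g.
Qed.

Lemma ae_eq_Rintegral (f g : T -> R) : {ae m, forall x, f x = g x} ->
  \int[m]_x f x = \int[m]_x g x.
Proof.
move=> fg; rewrite /Rintegral; congr fine; apply: ae_eq_integralT.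
by apply: filterS fg => x ->.
Qed.

(** Truncation to the band between [-|g|] and [|g|]; the absolute value keeps the band nonempty
    where the threshold [g] is negative. *)
Let clip (g f : T -> R) (x : T) : R :=
  Num.max (- `|g x|) (Num.min `|g x| (f x)).

Let clip_le g f x : `|clip g f x| <= `|g x|.
Proof.
rewrite /clip ler_norml le_max lexx/= ge_max ge_min lexx/= andbT.
by rewrite lerNl (le_trans _ (normr_ge0 _))// oppr_le0.
Qed.

(** Clipping moves values towards 0, and only where [|f|] exceeds [g], so the tail integral of
    [unif_integrable] bounds the truncation error. *)
Let clip_dist g f x :
  (`|(f x - clip g f x)%:E| <=
   ((fun y => (`|f y|)%:E) \_ [set x | (g x < `|f x|)%R]) x)%E.
Proof.
rewrite patchE /=; case: ifPn => [_|].
  rewrite lee_fin /clip.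
  have := normr_ge0 (g x); set a := `|g x| => a0.
  have [fa|af] := leP a (f x).
    rewrite max_r; last by rewrite (le_trans _ a0)// oppr_le0.
    by rewrite !ger0_norm ?subr_ge0// ?(le_trans a0)// gerBl.
  have [fa'|af'] := leP (- a) (f x).
    by rewrite subrr normr0.
  rewrite opprK !ler0_norm.
  - by rewrite opprD gerBl.
  - by rewrite (le_trans (ltW af'))// oppr_le0.
  - by rewrite -(opprK a) subr_le0 ltW.
rewrite notin_setE /= => /negP; rewrite -leNgt => fg.
have fa : `|f x| <= `|g x| by rewrite (le_trans fg)// ler_norm.
move: fa; rewrite ler_norml => /andP[fa1 fa2].
by rewrite /clip min_r// max_r// subrr normr0.
Qed.

Let measurable_clip g f : measurable_fun [set: T] g -> measurable_fun [set: T] f ->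
  measurable_fun [set: T] (clip g f).
Proof.
move=> mg mf; apply: measurable_maxr.
  by apply: measurable_funN; exact: measurableT_comp.
by apply: measurable_minr => //; exact: measurableT_comp.
Qed.

Lemma vitali_convergence (q : nat -> T -> R) (q0 : T -> R) :
  (forall n, measurable_fun [set: T] (q n)) ->
  (forall x, q ^~ x @ \oo --> q0 x) ->
  unif_integrable m [set: nat] q ->
  [/\ forall n, m.-integrable [set: T] (EFin \o q n),
      m.-integrable [set: T] (EFin \o q0) &
      \int[m]_x q n x @[n --> \oo] --> \int[m]_x q0 x].
Proof.
move=> mq qq0 ui.
have mq0 : measurable_fun [set: T] q0.
  by apply: (@measurable_fun_cvg _ _ _ _ q) => //.
(* Truncating at the threshold function of unif_integrable costs at most e and
   makes dominated convergence applicable. *)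
have key (e : R) : 0 < e -> exists (c : nat -> T -> R) (c0 : T -> R),
  [/\ forall n, m.-integrable [set: T] (EFin \o c n),
     m.-integrable [set: T] (EFin \o c0),
     \int[m]_x c n x @[n --> \oo] --> \int[m]_x c0 x,
     (forall n, \int[m]_x `|(q n x - c n x)%:E| <= e%:E)%E &
     (\int[m]_x `|(q0 x - c0 x)%:E| <= e%:E)%E].
  move=> e0; have [g ig Hg] := ui e e0.
  have mg : measurable_fun [set: T] g by exact/measurable_EFinP/(measurable_int m).
  pose c n := clip g (q n); pose c0 := clip g q0.
  have mc n : measurable_fun [set: T] (c n) by exact: measurable_clip.
  have mc0 : measurable_fun [set: T] c0 by exact: measurable_clip.
  have cc0 x : c n x @[n --> \oo] --> c0 x.
    pose k (y : R) : R := Num.max (- `|g x|) (Num.min `|g x| y).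
    have kc : continuous k.
      move=> y; apply: (@continuous_max _ _ (cst _) (fun y => Num.min `|g x| y)).
        exact: cvg_cst.
      by apply: (@continuous_min _ _ (cst _) id); [exact: cvg_cst|exact: cvg_id].
    apply: (@cvg_comp _ _ _ (q ^~ x) k _ (nbhs (q0 x))); [exact: qq0|exact: kc].
  have iag : m.-integrable [set: T] (fun x => `|(g x)%:E|)%E by exact: integrable_abse.
  have ic f : measurable_fun [set: T] f -> m.-integrable [set: T] (EFin \o clip g f).
    move=> mf; apply: le_integrable iag => //.
      by apply/measurable_EFinP; exact: measurable_clip.
    by move=> x _; rewrite /= lee_fin normr_id clip_le.
  have Hq n : (\int[m]_x `|(q n x - c n x)%:E| <= e%:E)%E.
    apply: le_trans (Hg n Logic.I).
    rewrite [leRHS]integral_mkcond; apply: ge0_le_integral => //.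
    + by apply/measurable_EFinP/measurableT_comp => //; exact: measurable_funB.
    + apply/(measurable_restrictT _ _).1.
      * rewrite -[X in measurable X]setTI.
        by apply: measurable_fun_ltr => //; exact: measurableT_comp.
      * by apply/measurable_EFinP; apply: measurable_funTS; exact: measurableT_comp.
    + by move=> x _; exact: clip_dist.
  exists c, c0; split.
  - by move=> n; exact: ic.
  - exact: ic.
  - have [] := @dominated_convergence _ _ _ m _ measurableT
      (fun n x => (c n x)%:E) (fun x => (c0 x)%:E) (fun x => `|(g x)%:E|)%E.
    + by move=> n; exact/measurable_EFinP.
    + exact/measurable_EFinP.
    + by apply: aeW => x _; apply: cvg_EFin; [exact: nearW|exact: cc0].
    + exact: iag.
    + by apply: aeW => x n _; rewrite lee_fin clip_le.
    move=> _ _ H; apply: fine_cvg => //=; rewrite fineK//.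
    exact: (integrable_fin_num measurableT (ic _ mq0)).
  - exact: Hq.
  (* Fatou's lemma passes the uniform bound [Hq] to the limit, as [|q n - c n|] converges pointwise
     to [|q0 - c0|]. *)
  - have cvgd x : (`|(q n x - c n x)%:E| @[n --> \oo] --> `|(q0 x - c0 x)%:E|)%E.
      apply: cvg_EFin; first exact: nearW.
      by apply: cvg_norm; apply: cvgB; [exact: qq0|exact: cc0].
    rewrite (_ : (fun x => _) = (fun x => limn_einf (fun n => `|(q n x - c n x)%:E|%E)));
      last first.
      apply/funext => x; rewrite is_cvg_limn_einfE.
        by apply/esym/cvg_lim => //; exact: cvgd.
      by apply/cvg_ex; eexists; exact: cvgd.
    apply: (le_trans (fatou _ _ _ _)) => //.
      by move=> n; apply/measurable_EFinP/measurableT_comp => //; exact: measurable_funB.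
    rewrite limn_einf_lim; apply: lime_le; first exact: is_cvg_einfs.
    apply: nearW => n; apply: le_trans (Hq n).
    by apply: ereal_inf_lbound; exists n => /=.
have intD (c f : T -> R) (e : R) : measurable_fun [set: T] f ->
    m.-integrable [set: T] (EFin \o c) ->
    (\int[m]_x `|(f x - c x)%:E| <= e%:E)%E ->
    m.-integrable [set: T] (EFin \o f) /\
    `|\int[m]_x f x - \int[m]_x c x| <= e.
  move=> mf ic fce.
  have mc : measurable_fun [set: T] c by exact/measurable_EFinP/(measurable_int m).
  have ifc : m.-integrable [set: T] (EFin \o (fun x => f x - c x)).
    apply/integrableP; split; last by rewrite (le_lt_trans fce)// ltry.
    by apply/measurable_EFinP; exact: measurable_funB.
  have i_f : m.-integrable [set: T] (EFin \o f).
    rewrite (_ : EFin \o f = (EFin \o (fun x => (f x - c x)%R)) \+ (EFin \o c))%E.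
      exact: integrableD.
    by apply/funext => x /=; rewrite -EFinD subrK.
  split => //; rewrite -RintegralB//.
  apply: (le_trans (le_normr_Rintegral _ _)) => //.
  rewrite -lee_fin /Rintegral fineK//.
  by apply: integrable_fin_num => //; exact: integrable_abse ifc.
(* Integrability needs only some finite L1 distance to an integrable truncation, so e = 1 is as good
   as any. *)
have iq n : m.-integrable [set: T] (EFin \o q n).
  have [c [c0 [ic _ _ + _]]] := key 1 ltr01.
  by move=> /(_ n) /(intD _ _ _ (mq n) (ic n))[].
have iq0 : m.-integrable [set: T] (EFin \o q0).
  have [c [c0 [_ ic _ _]]] := key 1 ltr01.
  by move=> /(intD _ _ _ mq0 ic)[].
split => //; apply/cvgrPdist_le => e e0.
have e30 : 0 < e / 3 by rewrite divr_gt0.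
have [c [c0 [ic ic0 /cvgrPdist_le/(_ _ e30) cc0 Hq Hq0]]] := key _ e30.
near=> n.
have h1 : `|\int[m]_x c0 x - \int[m]_x c n x| <= e / 3 by near: n.
have [_ h2] := intD _ _ _ (mq n) (ic n) (Hq n).
have [_ h3] := intD _ _ _ mq0 ic0 Hq0.
rewrite distrC in h2.
have := lerD (lerD h3 h1) h2.
have -> : e / 3 + e / 3 + e / 3 = e by field.
apply: le_trans.
apply: le_trans (lerD (ler_normD _ _) (lexx _)).
apply: le_trans (ler_normD _ _).
by rewrite le_eqVlt; apply/orP; left; apply/eqP; congr `|_|; ring.
Unshelve. all: by end_near. Qed.
End vitali_convergence.

(** * Vitali's theorem and linearity up to null sets *)

Section ae_vitali_convergence.
Context d (T : measurableType d) (R : realType).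
Variable m : {measure set T -> \bar R}.

Lemma ae_eq_unif_integrable (I : Type) (D : set I) (f g : I -> T -> R) :
  (forall i, D i -> {ae m, forall x, f i x = g i x}) ->
  unif_integrable m D f -> unif_integrable m D g.
Proof.
move=> fg ui e e0; have [h ih H] := ui e e0; exists h => // i Di.
apply: le_trans (H i Di); rewrite integral_mkcond [leRHS]integral_mkcond.
rewrite le_eqVlt; apply/orP; left; apply/eqP; apply: ae_eq_integralT.
apply: filterS (fg i Di) => x fgx; rewrite !patchE.
suff -> : (x \in [set y | h y < `|f i y|]) = (x \in [set y | h y < `|g i y|])
  by rewrite fgx.
by apply/idP/idP; rewrite !inE /= fgx.
Qed.

(** Vitali's theorem is applied to a constant sequence, for its integrability conclusion. *)
Lemma unif_integrable_ae_integrable (I : Type) (D : set I) (f : I -> T -> R) i :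
  D i -> ae_measurable m (f i) -> unif_integrable m D f -> ae_integrable m (f i).
Proof.
move=> Di [g mg fg] ui.
have ui' : unif_integrable m [set: nat] (fun=> g).
  apply: (@ae_eq_unif_integrable nat setT (fun=> f i)) => // e e0.
  by have [h ih H] := ui e e0; exists h => // _ _; exact: H.
have [//| |/(_ 0%N) ig _ _] := vitali_convergence _ _ ui' (q0 := g).
  by move=> x; exact: cvg_cst.
by exists g.
Qed.

Lemma ae_vitali_convergence (q : nat -> T -> R) (q0 : T -> R) :
  (forall n, ae_measurable m (q n)) ->
  {ae m, forall x, q ^~ x @ \oo --> q0 x} ->
  unif_integrable m [set: nat] q ->
  ae_integrable m q0 /\ \int[m]_x q n x @[n --> \oo] --> \int[m]_x q0 x.
Proof.
move=> mq qq0 ui.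
have /choice[g /all_and2[mg qg]] n : exists g : T -> R,
    measurable_fun [set: T] g /\ {ae m, forall x, q n x = g x}.
  by have [g mg qg] := mq n; exists g.
(* A single null set [N] carries all the exceptions; setting everything to 0 on it gives measurable
   functions that converge at every point. *)
have [N [mN N0 qgN]] : {ae m, forall x,
    (forall n, q n x = g n x) /\ q ^~ x @ \oo --> q0 x}.
  by apply: filterS2 (ae_foralln qg) qq0 => x.
pose g' n := (g n) \_ (~` N); pose q0' := q0 \_ (~` N).
have qg' n : {ae m, forall x, q n x = g' n x}.
  exists N; split => // x /= qg'x; apply: contrapT => Nx; apply: qg'x.
  rewrite /g' patchE mem_set//.
  by apply: contrapT => qgx; apply: Nx; apply: qgN => -[/(_ n)].
have qq0' : {ae m, forall x, q0 x = q0' x}.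
  exists N; split => // x /= qg'x; apply: contrapT => Nx; apply: qg'x.
  by rewrite /q0' patchE mem_set.
have [| | |_ iq0 cvg] := @vitali_convergence _ _ _ m g' q0'.
- move=> n; apply/(measurable_restrictT _ _).1; first exact: measurableC.
  exact: measurable_funTS.
- move=> x; rewrite /g' /q0'.
  have [Nx|Nx] := boolP (x \in ~` N); last first.
    rewrite patchE (negbTE Nx); under eq_fun do rewrite patchE (negbTE Nx).
    exact: cvg_cst.
  rewrite patchE Nx; under eq_fun do rewrite patchE Nx.
  have [qgx] : (forall n, q n x = g n x) /\ q ^~ x @ \oo --> q0 x.
    by apply: contrapT => /qgN; move: Nx; rewrite inE.
  by under eq_fun do rewrite qgx.
- by apply: ae_eq_unif_integrable ui => n _.
split; first by exists q0'.
rewrite (ae_eq_Rintegral qq0').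
by under eq_fun do rewrite (ae_eq_Rintegral (qg' _)).
Qed.

Lemma ae_measurableB (f g : T -> R) : ae_measurable m f -> ae_measurable m g ->
  ae_measurable m (fun x => f x - g x).
Proof.
move=> [f' mf ff'] [g' mg gg']; exists (fun x => f' x - g' x).
  exact: measurable_funB.
by apply: filterS2 ff' gg' => x -> ->.
Qed.

Lemma ae_measurableZ (k : R) (f : T -> R) : ae_measurable m f ->
  ae_measurable m (fun x => k * f x).
Proof.
move=> [f' mf ff']; exists (fun x => k * f' x).
  exact: measurable_funM.
by apply: filterS ff' => x ->.
Qed.

Lemma ae_integrableD (f g : T -> R) : ae_integrable m f -> ae_integrable m g ->
  ae_integrable m (fun x => f x + g x).
Proof.
move=> [f' mf ff'] [g' mg gg']; exists (fun x => f' x + g' x).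
  exact: (integrableD measurableT mf mg).
by apply: filterS2 ff' gg' => x -> ->.
Qed.

Lemma ae_integrableZ (k : R) (f : T -> R) : ae_integrable m f ->
  ae_integrable m (fun x => k * f x).
Proof.
move=> [f' mf ff']; exists (fun x => k * f' x).
  exact: (integrableZl measurableT k mf).
by apply: filterS ff' => x ->.
Qed.

Lemma ae_integrableB (f g : T -> R) : ae_integrable m f -> ae_integrable m g ->
  ae_integrable m (fun x => f x - g x).
Proof.
move=> [f' mf ff'] [g' mg gg']; exists (fun x => f' x - g' x).
  exact: (integrableB measurableT mf mg).
by apply: filterS2 ff' gg' => x -> ->.
Qed.

Lemma ae_RintegralB (f g : T -> R) : ae_integrable m f -> ae_integrable m g ->
  \int[m]_x (f x - g x) = \int[m]_x f x - \int[m]_x g x.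
Proof.
move=> [f' mf ff'] [g' mg gg'].
rewrite (ae_eq_Rintegral ff') (ae_eq_Rintegral gg') -RintegralB//.
by apply: ae_eq_Rintegral; apply: filterS2 ff' gg' => x -> ->.
Qed.

Lemma ae_RintegralZ (k : R) (f : T -> R) : ae_integrable m f ->
  \int[m]_x (k * f x) = k * \int[m]_x f x.
Proof.
move=> [f' mf ff'].
rewrite (ae_eq_Rintegral ff') -RintegralZl//.
by apply: ae_eq_Rintegral; apply: filterS ff' => x ->.
Qed.

End ae_vitali_convergence.

Lemma derivable_cvg_derive1 (R : realType) (f : R -> R) (t : R) :
  derivable f t 1 ->
  h^-1 *: (f (h + t) - f t) @[h --> 0^'] --> f^`()%classic t.
Proof. by rewrite /derivable /derive1 /=; under eq_fun do rewrite scaler1. Qed.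

(** * Differentiation under the integral sign *)

Section derivable_Rintegral.
Context d (T : measurableType d) (R : realType).
Variable m : {measure set T -> \bar R}.
Variables (f : R -> T -> R) (t : R).
Hypothesis ift : ae_integrable m (f t).
Hypothesis mf : \forall u \near t, ae_measurable m (f u).
Hypothesis df : {ae m, forall x, derivable (f ^~ x) t 1}.
Hypothesis uif : unif_integrable_diff_quotients m f t.

(** [f u] is [f t] plus [u - t] times a difference quotient, which is integrable as a member of the
    uniformly integrable family. *)
Lemma near_ae_integrable : \forall u \near t, ae_integrable m (f u).
Proof.
have [delta delta0 ui] := uif.
near=> u.
have [->//|ut] := eqVneq u t.
have mfu : ae_measurable m (f u) by near: u.
have udelta : `|u - t| < delta.
  by rewrite distrC; near: u; apply/nbhs_ballP; exists delta.
have u0 : u - t != 0 by rewrite subr_eq0.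
have := @unif_integrable_ae_integrable _ _ _ m _ _ _ (u - t) _ _ ui.
rewrite [t + _]addrC subrK => /(_ _ _)/(ae_integrableZ (u - t)) H.
have {}H : ae_integrable m (fun x => (u - t) * ((u - t)^-1 * (f u x - f t x))).
  apply: H; first by rewrite /= normr_gt0 u0.
  apply/ae_measurableZ/ae_measurableB => //; exact: ae_integrable_measurable.
have := ae_integrableD H ift.
by under eq_fun do rewrite mulrA divff// mul1r subrK.
Unshelve. all: by end_near. Qed.

Let cvg_derive : ae_integrable m (fun x => (f ^~ x)^`()%classic t) /\
  h^-1 *: (\int[m]_x f (h + t) x - \int[m]_x f t x) @[h --> 0^'] -->
  \int[m]_x (f ^~ x)^`()%classic t.
Proof.
have [delta delta0 ui] := uif.
(* Vitali's theorem concerns sequences, so the limit at 0 is tested along every sequence [u] of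
   nonzero increments. *)
have key (u : nat -> R) : (forall n, u n != 0) -> u n @[n --> \oo] --> 0 ->
    ae_integrable m (fun x => (f ^~ x)^`()%classic t) /\
    (u n)^-1 *: (\int[m]_x f (u n + t) x - \int[m]_x f t x) @[n --> \oo] -->
    \int[m]_x (f ^~ x)^`()%classic t.
  move=> u0 cu.
  (* Only a tail of [u] is known to have increments below [delta] and integrable [f (t + u n)]; the
     shift by [N] discards the other terms. *)
  have [N _ HN] : \forall n \near \oo,
      `|u n| < delta /\ ae_integrable m (f (t + u n)).
    apply: filterS2.
    - by move=> n; exact: conj.
    - by move/cvgr0Pnorm_lt : cu; exact.
    - have ctu : t + u n @[n --> \oo] --> t.
        by rewrite -[X in _ --> X]addr0; apply: cvgD => //; exact: cvg_cst.
      exact: ctu near_ae_integrable.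
  rewrite -(cvg_shiftn N) /=.
  pose q n x := (u (n + N)%N)^-1 * (f (t + u (n + N)%N) x - f t x).
  have HN' n : `|u (n + N)%N| < delta /\ ae_integrable m (f (t + u (n + N)%N)).
    by apply: HN; rewrite /= leq_addl.
  have [| | |iq0 cvgq] := @ae_vitali_convergence _ _ _ m q (fun x => (f ^~ x)^`()%classic t).
  - move=> n; apply/ae_measurableZ/ae_measurableB; apply: ae_integrable_measurable => //.
    by have [] := HN' n.
  - apply: filterS df => x /derivable_cvg_derive1/cvgr_dnbhsP.
    move=> /(_ (fun n => u (n + N)%N)) H; rewrite /q.
    under eq_fun do rewrite [t + _]addrC.
    by apply: H; split => //; rewrite (cvg_shiftn N).
  - move=> e e0; have [h ih H] := ui e e0; exists h => // n _.
    apply: H; rewrite /= normr_gt0 u0/=.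
    by have [] := HN' n.
  split => //.
  rewrite (_ : (fun n => _) = (fun n => \int[m]_x q n x))//.
  apply/funext => n; rewrite /q.
  have [_ iN] := HN' n.
  rewrite ae_RintegralZ; last by apply: ae_integrableB.
  by rewrite ae_RintegralB// [t + _]addrC.
split.
  (* Integrability of the derivative does not mention [u]; the harmonic sequence is one admissible
     choice. *)
  have harmonic_neq0 n : harmonic n != 0 :> R by rewrite invr_eq0 pnatr_eq0.
  by have [] := key _ harmonic_neq0 cvg_harmonic.
by apply/cvgr_dnbhsP => u [u0 cu]; have [] := key u u0 cu.
Qed.

Lemma derivable_Rintegral :
  [/\ derivable (fun u => \int[m]_x f u x) t 1,
      (fun u => \int[m]_x f u x)^`()%classic t =
        \int[m]_x (f ^~ x)^`()%classic t &
      ae_integrable m (fun x => (f ^~ x)^`()%classic t)].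
Proof.
have [iq cvgd] := cvg_derive.
split => //.
- apply/cvg_ex; eexists => /=; under eq_fun do rewrite scaler1; exact: cvgd.
- by rewrite /derive1; apply: cvg_lim.
Qed.

End derivable_Rintegral.

(** * Measures given by a density *)

Section density.
Local Open Scope ereal_scope.
Context d (T : measurableType d) (R : realType).
Variables (mu nu : {measure set T -> \bar R}) (p : T -> R).
Hypothesis mp : measurable_fun [set: T] p.
Hypothesis p0 : forall x, (0 <= p x)%R.
Hypothesis nuE : forall A, measurable A -> nu A = \int[mu]_(x in A) (p x)%:E.

Import HBNNSimple.

Let density_nnsfun (f : {nnsfun T >-> R}) :
  \int[nu]_x (f x)%:E = \int[mu]_x ((f x)%:E * (p x)%:E).
Proof.
under [LHS]eq_integral do rewrite fimfunE -fsumEFin//.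
rewrite [LHS]ge0_integral_fsum//; last 2 first.
  - by move=> r; exact/measurable_EFinP/measurableT_comp.
  - by move=> n x _; rewrite EFinM nnfun_muleindic_ge0.
under [RHS]eq_integral.
  move=> x xD; rewrite fimfunE -fsumEFin// muleC ge0_mule_fsumr; last first.
    by move=> r; rewrite EFinM nnfun_muleindic_ge0.
  over.
have mpE : measurable_fun [set: T] (fun x => (p x)%:E) by exact/measurable_EFinP.
rewrite [RHS]ge0_integral_fsum//; last 2 first.
  - move=> r; apply: emeasurable_funM => //.
    by apply/measurable_EFinP; apply/measurableT_comp.
  - move=> n x _; rewrite EFinM mule_ge0//; last by rewrite nnfun_muleindic_ge0.
    by rewrite lee_fin.
apply: eq_fsbigr => r _.
rewrite integralZl_indic_nnsfun// integral_indic// setIT nuE//.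
rewrite integral_mkcond.
have [r0|r0] := leP 0%R r.
  rewrite -ge0_integralZl//; last 2 first.
  - by apply/(measurable_restrictT _ _).1 => //; exact: measurable_funTS.
  - by move=> x _; rewrite patchE; case: ifPn; rewrite ?lee_fin.
  apply: eq_integral => x _; rewrite patchE indicE.
  by case: ifPn => _; rewrite ?mulr1 ?mulr0 ?mule0// muleC.
(* A nonnegative simple function never takes the negative value [r], so both sides vanish. *)
rewrite (_ : f @^-1` [set r] = set0); last first.
  by rewrite preimage_nnfun0.
rewrite patch_set0 integral0 mule0 integral0_eq// => x _.
by rewrite indicE in_set0 mulr0 mule0.
Qed.

(** Turns integrals against [normal_prob] into Lebesgue integrals: simple functions, then monotone
    convergence on both sides. *)
Lemma ge0_integral_density (f : T -> \bar R) : measurable_fun [set: T] f ->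
  (forall x, 0 <= f x) -> \int[nu]_x f x = \int[mu]_x (f x * (p x)%:E).
Proof.
move=> mf f0; pose f_ := nnsfun_approx measurableT mf.
have mpE : measurable_fun [set: T] (fun x => (p x)%:E) by exact/measurable_EFinP.
have mf_ n : measurable_fun [set: T] (fun x => (f_ n x)%:E).
  exact/measurable_EFinP/measurable_funTS.
transitivity (lim (\int[nu]_x (f_ n x)%:E @[n --> \oo])).
  rewrite -monotone_convergence//=.
  - by apply: eq_integral => x _; apply/esym/cvg_lim => //; exact: cvg_nnsfun_approx.
  - by move=> n x _; rewrite lee_fin.
  - by move=> x _ a b ab; rewrite lee_fin; exact/lefP/nd_nnsfun_approx.
under eq_fun do rewrite density_nnsfun.
rewrite -monotone_convergence//=.
- apply: eq_integral => x _; apply/cvg_lim => //.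
  by apply: cvgeZr => //; exact: cvg_nnsfun_approx.
- by move=> n; exact: emeasurable_funM.
- by move=> n x _; rewrite mule_ge0// lee_fin.
- move=> x _ a b ab; rewrite lee_wpmul2r ?lee_fin//.
  exact/lefP/nd_nnsfun_approx.
Qed.

End density.

(** * Affine changes of variables *)

Section affine_change_of_variables.
Local Open Scope ereal_scope.
Context (R : realType).
Local Notation mu := (@lebesgue_measure R).
Implicit Types (m s : R).

Let aff m s (z : measurableTypeR R) : measurableTypeR R := (m + s * z)%R.

Let measurable_aff m s : measurable_fun [set: R] (aff m s).
Proof. by apply: measurable_funD => //; exact: measurable_funM. Qed.

(** [|s|] times the image of Lebesgue measure under the affine map gives half-open intervals their
    length, hence is Lebesgue measure by uniqueness. *)
Lemma lebesgue_measure_affine m s (A : set R) : s != 0%R -> measurable A ->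
  mu A = `|s|%:E * mu ((fun z => m + s * z)%R @^-1` A).
Proof.
move=> s0 mA.
pose nu : {measure set (measurableTypeR R) -> \bar R} :=
  mscale (NngNum (normr_ge0 s)) (pushforward mu (aff m s)).
rewrite (@lebesgue_measure_unique R (nu (@measurable_aff m s)) _ A mA)// => _ [[a b]] _ <-.
change (mu `]a, b] = `|s|%:E * mu (aff m s @^-1` `]a, b]))%classic.
rewrite lebesgue_measure_itv lte_fin.
have [sgt|slt] : (0 < s)%R \/ (s < 0)%R by apply/orP; rewrite orbC -neq_lt.
- rewrite (_ : aff m s @^-1` _ = `]((a - m) / s)%R, ((b - m) / s)%R]%classic); last first.
    apply/seteqP; split => z /=; rewrite !in_itv/= /aff.
      by rewrite ltr_pdivrMr// ler_pdivlMr// ltrBlDl lerBrDl mulrC.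
    by rewrite ltr_pdivrMr// ler_pdivlMr// ltrBlDl lerBrDl mulrC.
  rewrite lebesgue_measure_itv/= !lte_fin ltr_pM2r ?invr_gt0// ltrD2r.
  case: ifPn => _; last by rewrite mule0.
  by rewrite -!EFinD -EFinM gtr0_norm//; congr EFin; field.
(* A negative slope swaps the endpoints and moves the closed end to the left, which leaves the
   length unchanged. *)
- rewrite (_ : aff m s @^-1` _ = `[((b - m) / s)%R, ((a - m) / s)%R[%classic); last first.
    apply/seteqP; split => z /=; rewrite !in_itv/= /aff.
      by rewrite ltr_ndivlMr// ler_ndivrMr// ltrBlDl lerBrDl mulrC andbC.
    by rewrite ltr_ndivlMr// ler_ndivrMr// ltrBlDl lerBrDl mulrC andbC.
  rewrite lebesgue_measure_itv/= !lte_fin ltr_nM2r ?invr_lt0// ltrD2r.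
  case: ifPn => _; last by rewrite mule0.
  by rewrite -!EFinD -EFinM ltr0_norm//; congr EFin; field.
Qed.

Lemma ge0_integral_affine m s (f : R -> \bar R) : s != 0%R ->
  measurable_fun [set: R] f -> (forall x, 0 <= f x) ->
  \int[mu]_x f x = `|s|%:E * \int[mu]_z f (m + s * z)%R.
Proof.
move=> s0 mf f0.
pose nu : {measure set (measurableTypeR R) -> \bar R} :=
  mscale (NngNum (normr_ge0 s)) (pushforward mu (aff m s)).
transitivity (\int[nu (@measurable_aff m s)]_x f x).
  apply: eq_measure_integral => A mA _.
  by have := lebesgue_measure_affine m s0 mA.
rewrite ge0_integral_mscale//=.
by rewrite ge0_integral_pushforward//; exact: measurable_aff.
Qed.

End affine_change_of_variables.

(** * The normal law as an affine image of the standard one *)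

Section normal_affine.
Context (R : realType).
Local Notation mu := (@lebesgue_measure R).
Implicit Types (m s : R) (f : R -> R).

(** The Jacobian [|s|] cancels the factor [1/|s|] in the peak. The absolute value matters because
    [sigma], hence [s], may be negative. *)
Lemma normal_pdf_affine m s (z : R) : s != 0 ->
  `|s| * normal_pdf m s (m + s * z) = normal_pdf 0 1 z.
Proof.
move=> s0; rewrite !normal_pdfE ?oner_neq0// mulrA; congr (_ * _).
  rewrite /normal_peak -mulrnAr sqrtrM ?sqr_ge0// sqrtr_sqr invfM mulrA.
  by rewrite divff ?normr_eq0// mul1r expr1n mul1r.
rewrite /normal_fun; congr expR.
by rewrite subr0 expr1n; field; rewrite s0.
Qed.

Lemma ge0_integral_normal_affine m s (f : R -> \bar R) : s != 0 ->
  measurable_fun [set: R] f -> (forall x, 0 <= f x)%E ->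
  (\int[mu]_x (f x * (normal_pdf m s x)%:E) =
   \int[normal_prob 0 1]_z f (m + s * z)%R)%E.
Proof.
move=> s0 mf f0.
have maff : measurable_fun [set: R] (fun z : R => m + s * z).
  by apply: measurable_funD => //; exact: measurable_funM.
rewrite (ge0_integral_affine m s0); last 2 first.
- apply: emeasurable_funM => //.
  by apply/measurable_EFinP; exact: measurable_normal_pdf.
- by move=> x; rewrite mule_ge0// lee_fin normal_pdf_ge0.
rewrite (@ge0_integral_density _ _ _ mu (normal_prob 0 1) (normal_pdf 0 1))//; last 3 first.
- exact: measurable_normal_pdf.
- by move=> x; exact: normal_pdf_ge0.
- exact: measurableT_comp.
rewrite -ge0_integralZl//=.
- apply: eq_integral => z _.
  by rewrite muleCA -EFinM normal_pdf_affine.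
- apply: emeasurable_funM => //; first exact: measurableT_comp.
  apply/measurable_EFinP; apply: (measurableT_comp _ maff).
  exact: measurable_normal_pdf.
- by move=> x _; rewrite mule_ge0// lee_fin normal_pdf_ge0.
Qed.

(** Positive and negative parts are treated separately, so integrability is not presupposed; [FgE]
    relies on this at all parameters near [t]. *)
Lemma integral_normal_affine m s f : s != 0 -> measurable_fun [set: R] f ->
  (\int[mu]_x (f x * normal_pdf m s x)%:E =
   \int[normal_prob 0 1]_z (f (m + s * z)%R)%:E)%E.
Proof.
move=> s0 mf; rewrite integralE [RHS]integralE; congr (_ - _)%E.
- under [RHS]eq_integral do rewrite funeposE/=.
  rewrite -(@ge0_integral_normal_affine m s (fun x => maxe (f x)%:E 0%E))//.
  + apply: eq_integral => x _; rewrite funeposE EFinM maxe_pMl ?mul0e//.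
    by rewrite lee_fin normal_pdf_ge0.
  + by apply: measurable_maxe => //; exact/measurable_EFinP.
  + by move=> x; rewrite le_max lexx orbT.
- under [RHS]eq_integral do rewrite funenegE/=.
  rewrite -(@ge0_integral_normal_affine m s (fun x => maxe (- (f x)%:E)%E 0%E))//.
  + apply: eq_integral => x _; rewrite funenegE EFinM maxe_pMl ?mul0e ?mulNe//.
    by rewrite lee_fin normal_pdf_ge0.
  + apply: measurable_maxe => //; apply: measurableT_comp => //.
    exact/measurable_EFinP.
  + by move=> x; rewrite le_max lexx orbT.
Qed.

Lemma integrable_normal_affine m s f : s != 0 -> measurable_fun [set: R] f ->
  (normal_prob 0 1).-integrable [set: R] (EFin \o (fun z => f (m + s * z))) ->
  mu.-integrable [set: R] (EFin \o (fun x => f x * normal_pdf m s x)).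
Proof.
move=> s0 mf /integrableP[_ intf]; apply/integrableP; split.
  apply/measurable_EFinP; apply: measurable_funM => //.
  exact: measurable_normal_pdf.
apply: le_lt_trans intf.
rewrite -(@ge0_integral_normal_affine m s (fun x => `|(f x)%:E|%E))//.
  under eq_integral do rewrite /= normrM (ger0_norm (normal_pdf_ge0 _ _ _)) EFinM.
  exact: lexx.
by apply: measurableT_comp => //; exact/measurable_EFinP.
Qed.

End normal_affine.

(** * Independence of one Gaussian variable from finitely many others *)

Section independence.
Context d (Omega : measurableType d) (R : realType) (P : probability Omega R).
Variables (Z : nat -> {RV P >-> R}) (J : seq nat) (k0 : nat) (D : set nat).
Hypothesis uJ : uniq (k0 :: J).
Hypothesis JD : forall k, k \in k0 :: J -> D k.
Hypothesis Z_indep : mutually_independent P D (fun k => Z k : Omega -> R).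

(** The pi-system that generates the sigma-algebra of the variables indexed by [J]. *)
Definition cylinders : set (set Omega) := [set B |
  exists2 A : nat -> set R, (forall k, measurable (A k)) &
    B = \bigcap_(k in [set` J]) (Z k @^-1` A k)].

Lemma setI_closed_cylinders : setI_closed cylinders.
Proof.
move=> _ _ [A mA ->] [A' mA' ->]; exists (fun k => A k `&` A' k).
  by move=> k; exact: measurableI.
by rewrite -bigcapI; apply: eq_bigcapr => k _; rewrite preimage_setI.
Qed.

Lemma measurable_cylinders B : cylinders B -> measurable B.
Proof.
move=> [A mA ->]; apply: fin_bigcap_measurable; first exact: finite_seq.
by move=> k _; rewrite -[X in measurable X]setTI; exact: measurable_funP.
Qed.

Lemma sigma_cylinders_measurable B : <<s cylinders >> B -> measurable B.
Proof.
move: B; apply: smallest_sub; last exact: measurable_cylinders.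
exact: sigma_algebra_measurable.
Qed.

Local Open Scope ereal_scope.

(** Dynkin's argument: the events independent of a fixed event on [Z k0] form a lambda-system, and
    it contains the pi-system of cylinders. *)
Lemma cylinders_independent B C : <<s cylinders >> B -> measurable C ->
  P (B `&` Z k0 @^-1` C) = P B * P (Z k0 @^-1` C).
Proof.
move=> sB mC; set E := Z k0 @^-1` C.
have mE : measurable E.
  by rewrite -[X in measurable X]setTI; exact: measurable_funP.
pose H : set (set Omega) := [set A | measurable A /\ P (A `&` E) = P A * P E].
suff : <<s cylinders >> `<=` H by move=> /(_ _ sB)[].
apply: lambda_system_subset => //; first exact: setI_closed_cylinders.
- apply/dynkin_lambda_system; split.
  + by split => //; rewrite setTI probability_setT mul1e.
  + move=> A [mA AE]; split; first exact: measurableC.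
    have PEA : P (E `\` A) = P E - P (A `&` E).
      rewrite [A `&` E]setIC; apply: measureD => //.
      by rewrite (le_lt_trans (probability_le1 _ _))// ltry.
    rewrite (setIC (~` A)) -setDE PEA AE.
    rewrite probability_setC// muleBl//.
      by rewrite mul1e.
    exact: fin_num_measure.
  + move=> F tF HF; have mF k : measurable (F k) by have [] := HF k.
    split; first exact: bigcup_measurable.
    rewrite setI_bigcupl measure_bigcup//; last 2 first.
    * by move=> k _; exact: measurableI.
    * exact: trivIset_setIr.
    rewrite measure_bigcup// muleC -(fineK (fin_num_measure P E mE)).
    rewrite -nneseriesZl//; apply: eq_eseriesr => k _.
    by rewrite fineK ?fin_num_measure// muleC; have [] := HF k.
- move=> _ [A mA ->]; split.
    by apply: measurable_cylinders; exists A.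
  (* Placing [C] at index [k0] turns the cylinder intersected with [E] into a cylinder over
     [k0 :: J]; as [k0] does not occur in [J], the constraints on [J] are kept. *)
  pose A' k := if k == k0 then C else A k.
  have k0J : k0 \notin J by move: uJ => /andP[].
  have AA' k : k \in J -> A' k = A k.
    by rewrite /A'; case: eqVneq => [->|//]; rewrite (negbTE k0J).
  have mA' k : measurable (A' k) by rewrite /A'; case: ifP.
  have h1 := Z_indep uJ JD mA'.
  have h2 := Z_indep (andP uJ).2 (fun k kJ => JD (mem_behead (s := k0 :: J) kJ)) mA.
  rewrite h2.
  rewrite big_cons in h1; rewrite (_ : A' k0 = C) in h1; last by rewrite /A' eqxx.
  rewrite muleC (_ : \prod_(k <- J) P (Z k @^-1` A k) =
    \prod_(k <- J) P (Z k @^-1` A' k)); last first.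
    by apply: eq_big_seq => k kJ; rewrite AA'.
  rewrite -h1; congr (P _); apply/seteqP; split => w /=.
    move=> [wA wC] k /=; rewrite inE => /predU1P[->|kJ].
      by rewrite /A' eqxx.
    by rewrite AA'//; exact: wA.
  move=> wA; split.
    by move=> k kJ /=; rewrite -AA'//; apply: wA; rewrite /= inE kJ orbT.
  by have := wA k0; rewrite /= /A' eqxx; apply; rewrite inE eqxx.
Qed.

End independence.

(** * Freezing the past *)

Section freezing.
Context d (Omega : measurableType d) (R : realType) (P : probability Omega R).
Variables (Y1 Y2 : Omega -> R) (Zn : {RV P >-> R}) (V : R -> R).
Hypotheses (mY1 : measurable_fun [set: Omega] Y1)
  (mY2 : measurable_fun [set: Omega] Y2) (mV : measurable_fun [set: R] V).
Hypothesis Zn_normal : forall A : set R, measurable A ->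
  distribution P Zn A = normal_prob (0 : R) 1 A.
Hypothesis YZ_indep : forall (A : set (R * R)) (B : set R),
  measurable A -> measurable B ->
  (P ((fun w => (Y1 w, Y2 w)) @^-1` A `&` Zn @^-1` B) =
   P ((fun w => (Y1 w, Y2 w)) @^-1` A) * P (Zn @^-1` B))%E.
Hypothesis EV : ('E_P[fun w => (`|V (Y1 w + Y2 w * Zn w)|)%R] < +oo)%E.

Let Y w := (Y1 w, Y2 w).
Let mY : measurable_fun [set: Omega] Y.
Proof. exact: measurable_fun_pair. Qed.

Let Y_mixin := isMeasurableFun.Build _ _ _ _ _ mY.
Let Ym : {mfun Omega >-> (R * R)%type} := HB.pack Y Y_mixin.

Let YZ w : (R * R) * R := (Y w, Zn w).
Let mYZ : measurable_fun [set: Omega] YZ.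
Proof. by apply: measurable_fun_pair => //; exact: measurable_funP. Qed.

Let f (y : (R * R) * R) : \bar R := (V (y.1.1 + y.1.2 * y.2))%:E.
Let mf : measurable_fun [set: (R * R) * R] f.
Proof.
apply/measurable_EFinP; apply: (measurableT_comp mV).
apply: measurable_funD.
  exact: (measurableT_comp measurable_fst measurable_fst).
apply: measurable_funM; last exact: measurable_snd.
exact: (measurableT_comp measurable_snd measurable_fst).
Qed.

Let integral_Zn (g : R -> \bar R) : measurable_fun [set: R] g ->
  (\int[distribution P Zn]_z g z = \int[normal_prob 0 1]_z g z)%E.
Proof.
(* [idR] carries the Gaussian law from [measurableTypeR R] to [R]; as a map it is the identity. *)
pose idR : measurableTypeR R -> R := idfun.
have midR : measurable_fun setT idR by exact: measurable_id.
have ge0 (k : R -> \bar R) : measurable_fun [set: R] k -> (forall x, 0 <= k x)%E ->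
    (\int[distribution P Zn]_z k z = \int[normal_prob 0 1]_z k z)%E.
  move=> mk k0.
  transitivity (\int[pushforward (normal_prob 0 1) idR]_z k z)%E.
    by apply: eq_measure_integral => A mA _; exact: Zn_normal.
  by rewrite ge0_integral_pushforward.
move=> mg; rewrite integralE [RHS]integralE; congr (_ - _)%E; apply: ge0 => //.
- exact: measurable_funepos.
- exact: measurable_funeneg.
Qed.

(** Independence gives equality on measurable rectangles, and these determine a product of
    probability measures. *)
Let lawE (A : set ((R * R) * R)) : measurable A ->
  (distribution P Ym \x distribution P Zn)%E A = pushforward P YZ A.
Proof.
move=> mA; pose m' : {measure set ((R * R) * R) -> \bar R} := pushforward P YZ.
have H := @product_measure_unique _ _ _ _ _ (distribution P Ym)
  (distribution P Zn) (m' mYZ).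
by apply: H => // B C mB mC; exact: YZ_indep.
Qed.

Let if_YZ : P.-integrable [set: Omega] (f \o YZ).
Proof.
apply/integrableP; split; first exact: (measurableT_comp mf mYZ).
by move: EV; rewrite unlock.
Qed.

Let i_f : (distribution P Ym \x distribution P Zn)%E.-integrable setT f.
Proof.
apply/integrableP; split => //.
have /integrableP[_] := integrable_pushforward mYZ mf if_YZ measurableT.
by congr (_ < _)%E; apply: eq_measure_integral => A mA _; exact/esym/lawE.
Qed.

Let F := fubini_F (distribution P Zn) f.

(** Fubini under the joint law, a product by [lawE]: the pair [Y] is held fixed while [Zn] is
    integrated out. *)
Lemma expectation_freezing :
  P.-integrable [set: Omega] (fun w =>
    (gauss_expectation (fun z => V (Y1 w + Y2 w * z)))%:E) /\
  ('E_P[fun w => (V (Y1 w + Y2 w * Zn w))%R] =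
   \int[P]_w (gauss_expectation (fun z => V (Y1 w + Y2 w * z))%R)%:E)%E.
Proof.
have mF : measurable_fun setT F by exact: measurable_fubini_F i_f.
have iF : (distribution P Ym).-integrable setT F by exact: integrable_fubini_F i_f.
have iFY : P.-integrable setT (F \o Y).
  apply/integrableP; split; first exact: measurableT_comp.
  have /integrableP[_] := iF.
  by rewrite ge0_integral_pushforward//; exact: measurableT_comp.
have FE w : F (Y w) = (\int[normal_prob 0 1]_z (V (Y1 w + Y2 w * z))%:E)%E.
  rewrite /F /fubini_F integral_Zn//.
  by apply: (measurableT_comp mf); exact: measurable_fun_pair.
(* [gauss_expectation] is the [fine] part of an extended integral, faithful only where that integral
   is finite; integrability of [F \o Y] ensures this almost everywhere. *)
have GF : {ae P, forall w,
    (gauss_expectation (fun z => V (Y1 w + Y2 w * z)))%:E = F (Y w)}.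
  apply: filterS (integrable_ae measurableT iFY) => w /(_ I) Ffin.
  by rewrite FE fineK// -FE.
split.
  apply/integrableP; split.
    apply/measurable_EFinP; rewrite /gauss_expectation /Rintegral.
    under eq_fun do rewrite -FE.
    by apply: measurableT_comp => //; exact: (measurableT_comp mF mY).
  rewrite (@ae_eq_integralT _ _ _ _ _ (fun w => `|F (Y w)|%E)).
    by have /integrableP[] := iFY.
  by apply: filterS GF => w <-.
rewrite (ae_eq_integralT GF) unlock.
transitivity (\int[pushforward P YZ]_y f y)%E.
  by rewrite (integral_pushforward mYZ mf).
transitivity (\int[(distribution P Ym \x distribution P Zn)%E]_y f y)%E.
  by apply: eq_measure_integral => A mA _; exact/esym/lawE.
rewrite -integral12_prod_meas1//.
by rewrite (integral_pushforward mY).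
Qed.

End freezing.

(** * The Euler scheme and its last step *)

Section euler_expectation.
Context d (Omega : measurableType d) (R : realType) (P : probability Omega R).
Variables (Theta : set R) (b sigma : R -> R -> R) (X0 : R -> R) (h : R).
Hypotheses (b_cont : jointly_continuous Theta b)
  (sigma_cont : jointly_continuous Theta sigma).

Lemma jointly_continuous_section (f : R -> R -> R) (theta : R) :
  jointly_continuous Theta f -> Theta theta -> continuous (f theta).
Proof.
move=> /subspace_continuousP fc Thetat x.
apply: (@cvg_comp _ _ _ (fun y => (theta, y)) (fun p => f p.1 p.2) _
  (within (Theta `*` setT) (nbhs (theta, x)))); last by apply: fc.
have ct : (fun=> theta) @ x --> theta by exact: cvg_cst.
have pc := cvg_pair ct (@cvg_id _ (nbhs x)).
move=> B /pc H; suff : nbhs x [set y | B (theta, y)] by [].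
have {}H : nbhs x [set y | (Theta `*` setT) (theta, y) -> B (theta, y)] by [].
by apply: filterS H => y /=; apply.
Qed.

(** The source [U] is left free so that the lemma applies to the sample space with the smaller
    sigma-algebra of the earlier Gaussian variables. *)
Lemma measurable_euler d' (U : measurableType d') (z : nat -> U -> R)
    (theta : R) (j : nat) : Theta theta ->
  (forall k, (0 < k <= j)%N -> measurable_fun [set: U] (z k)) ->
  measurable_fun [set: U] (fun w => euler b sigma X0 h theta (fun k => z k w) j).
Proof.
move=> Tt; elim: j => [|j IHj] mz; first exact: measurable_cst.
have mX : measurable_fun [set: U] (fun w => euler b sigma X0 h theta (fun k => z k w) j).
  by apply: IHj => k /andP[k0 kj]; apply: mz; rewrite k0 leqW.
have mbX (f : R -> R -> R) : jointly_continuous Theta f ->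
    measurable_fun [set: U] (fun w => f theta (euler b sigma X0 h theta (fun k => z k w) j)).
  move=> fc; apply: measurableT_comp mX; apply: continuous_measurable_fun.
  by apply: jointly_continuous_section fc _.
apply: measurable_funD; first apply: measurable_funD => //.
  by apply: measurable_funM => //; exact: mbX.
apply: measurable_funM; last by apply: mz; rewrite leqnn.
by apply: measurable_funM => //; exact: mbX.
Qed.

Variables (n : nat) (Z : nat -> {RV P >-> R}) (V : R -> R).
Hypotheses (n_gt0 : (0 < n)%N).
Hypothesis Z_normal : forall k : nat, (0 < k <= n)%N ->
  forall A : set R, measurable A ->
    distribution P (Z k) A = normal_prob (0 : R) 1 A.
Hypothesis Z_indep : mutually_independent P [set k : nat | (0 < k <= n)%N]
  (fun k => Z k : Omega -> R).
Hypothesis V_borel : measurable_fun [set: R] V.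

Let X (theta : R) (w : Omega) := euler b sigma X0 h theta (fun k => Z k w) n.
Let mu (theta : R) (w : Omega) := euler_mu b sigma X0 h n theta (fun k => Z k w).
Let s (theta : R) (w : Omega) := euler_s b sigma X0 h n theta (fun k => Z k w).

Lemma euler_mu_s theta w : X theta w = mu theta w + s theta w * Z n w.
Proof.
rewrite /X /mu /s /euler_mu /euler_s.
case: n n_gt0 => // j _ /=.
by rewrite mulrC [sigma _ _ * _]mulrC mulrC [_ * h]mulrC.
Qed.

Lemma expectation_euler theta : Theta theta ->
  ('E_P[fun w => (`|V (X theta w)|)%R] < +oo)%E ->
  P.-integrable [set: Omega] (fun w =>
    (gauss_expectation (fun z => V (mu theta w + s theta w * z)))%:E) /\
  ('E_P[fun w => V (X theta w)] =
   \int[P]_w (gauss_expectation (fun z => V (mu theta w + s theta w * z))%R)%:E)%E.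
Proof.
move=> Tt EV.
(* [J] lists 1, ..., n-1; it is empty when [n] is 1, and then [mu] and [s] are deterministic. *)
pose J := iota 1 n.-1.
have nJ : n :: J =i [pred k | 0 < k <= n]%N.
  by move=> k; rewrite inE mem_iota !inE; apply/idP/idP; lia.
(* Measurability on [U] expresses that [mu] and [s] depend on Z_1, ..., Z_(n-1) alone. *)
pose U := g_sigma_algebraType (cylinders Z J).
have mZ k : k \in J -> measurable_fun [set: U] (Z k : U -> R).
  move=> kJ _ B mB; rewrite setTI; apply: sub_sigma_algebra.
  exists (fun j => if j == k then B else setT); first by move=> j; case: ifP.
  apply/seteqP; split => w /=.
    by move=> wB j /= _; case: eqVneq => [->|].
  by move=> /(_ k kJ); rewrite eqxx.
have mE : measurable_fun [set: U] (fun w : U => euler b sigma X0 h theta (fun k => Z k w) n.-1).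
  apply: measurable_euler => // k kn; apply: mZ.
  by rewrite mem_iota; lia.
have mfE (f : R -> R -> R) : jointly_continuous Theta f -> measurable_fun [set: U]
    (fun w => f theta (euler b sigma X0 h theta (fun k => Z k w) n.-1)).
  move=> fc; apply: measurableT_comp mE; apply: continuous_measurable_fun.
  by apply: jointly_continuous_section fc _.
have mmu : measurable_fun [set: U] (mu theta : U -> R).
  by apply: (measurable_funD mE); apply: measurable_funM => //; exact: mfE.
have ms : measurable_fun [set: U] (s theta : U -> R).
  by apply: measurable_funM => //; exact: mfE.
have UOmega (f : Omega -> R) : measurable_fun [set: U] (f : U -> R) ->
    measurable_fun [set: Omega] f.
  move=> mf _ B mB; rewrite setTI; apply: (@sigma_cylinders_measurable _ _ _ P Z J).
  by have := mf measurableT B mB; rewrite setTI.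
have XE : X theta = (fun w => mu theta w + s theta w * Z n w).
  by apply/funext => w; exact: euler_mu_s.
have indep (A : set (R * R)) (B : set R) : measurable A -> measurable B ->
  (P ((fun w => (mu theta w, s theta w)) @^-1` A `&` Z n @^-1` B) =
   P ((fun w => (mu theta w, s theta w)) @^-1` A) * P (Z n @^-1` B))%E.
  move=> mA mB; apply: (cylinders_independent (J := J) _ _ Z_indep) => //.
  - rewrite /= iota_uniq mem_iota andbT; lia.
  - by move=> k; rewrite nJ.
  - by have := measurable_fun_pair mmu ms measurableT mA; rewrite setTI.
rewrite XE in EV *.
by apply: expectation_freezing => //; [exact: UOmega|exact: UOmega|apply: Z_normal; lia].
Qed.

End euler_expectation.

(** * Derivatives of the normal density along a curve of parameters *)

Section pointwise_derivatives.
Context (R : realType).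
Implicit Types (f g a c : R -> R) (t x : R).

Lemma derivable_is_derive1 f t : derivable f t 1 ->
  is_derive t 1 f (f^`()%classic t).
Proof. by move=> df; rewrite derive1E; exact: derivableP. Qed.

Lemma is_derive1_derivable f t df : is_derive t 1 f df ->
  derivable f t 1 /\ f^`()%classic t = df.
Proof. by move=> [? <-]; rewrite derive1E. Qed.

Lemma near_eq_derive1 f g t : (\forall u \near t, f u = g u) ->
  \forall u \near t, f^`()%classic u = g^`()%classic u.
Proof.
move=> /near_join fg; near=> u; rewrite !derive1E.
by apply: near_eq_derive; near: u.
Unshelve. all: by end_near. Qed.

Let is_deriveD1 f g t df dg : is_derive t 1 f df -> is_derive t 1 g dg ->
  is_derive t 1 (fun u => f u + g u) (df + dg).
Proof. by move=> *; exact: is_deriveD. Qed.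

Let is_deriveM1 f g t df dg : is_derive t 1 f df -> is_derive t 1 g dg ->
  is_derive t 1 (fun u => f u * g u) (f t * dg + g t * df).
Proof. by move=> *; exact: is_deriveM. Qed.

Let is_deriveV1 f t df : f t != 0 -> is_derive t 1 f df ->
  is_derive t 1 (fun u => (f u)^-1) (- df / f t ^+ 2).
Proof.
move=> ft0 fd; apply: (is_derive_eq (is_deriveV ft0 fd)).
by rewrite /GRing.scale/=; field.
Qed.

Let is_deriveBx f x t df : is_derive t 1 f df ->
  is_derive t 1 (fun u => x - f u) (- df).
Proof.
move=> fd; rewrite -[- df]add0r.
by apply: is_deriveB => //; exact: is_derive_cst.
Qed.

(* The partial derivatives of ln (normal_pdf m s x) in m and in s. *)
Definition score_mu m s x : R := (x - m) / s ^+ 2.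
Definition score_s m s x : R := (x - m) ^+ 2 / s ^+ 3 - s^-1.

Lemma is_derive_normal_pdf a c t x da dc : c t != 0 ->
  is_derive t 1 a da -> is_derive t 1 c dc ->
  is_derive t 1 (fun u => normal_pdf (a u) (c u) x)
    (normal_pdf (a t) (c t) x *
     (da * score_mu (a t) (c t) x + dc * score_s (a t) (c t) x)).
Proof.
move=> ct0 ad cd.
have cc : {for t, continuous c}.
  by apply/differentiable_continuous/derivable1_diffP; case: cd.
(* normal_peak depends on `|c u|, and c has the constant sign e near t. *)
have [e e0 ce] : exists2 e : R, e ^+ 2 = 1 & \forall u \near t, c u != 0 /\ `|c u| = e * c u.
  have [ctp|ctn] : 0 < c t \/ c t < 0 by apply/orP; rewrite orbC -neq_lt.
    exists 1; rewrite ?expr1n//; near=> u.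
    have cu : 0 < c u by near: u; exact: (cvgr_gt _ cc).
    by rewrite gt_eqF// gtr0_norm// mul1r.
  exists (-1); rewrite ?sqrrN ?expr1n//; near=> u.
  have cu : c u < 0 by near: u; exact: (cvgr_lt _ cc).
  by rewrite lt_eqF// ltr0_norm// mulN1r.
pose S : R := Num.sqrt (pi *+ 2).
have S0 : S != 0 by rewrite gt_eqF// sqrtr_gt0 pmulrn_lgt0// pi_gt0.
have e_neq0 : e != 0.
  by apply/eqP => e00; move: e0; rewrite e00 expr0n/= => /eqP; rewrite eq_sym oner_eq0.
(* Near [t] the density takes a form without absolute values, built from products, inverses and an
   exponential, to which the derivation rules apply directly. *)
have pdfE : \forall u \near t,
    (e / S) * (c u)^-1 * expR (- 2^-1 * ((x - a u) * (x - a u) * ((c u)^-1 * (c u)^-1))) =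
    normal_pdf (a u) (c u) x.
  near=> u.
  have [cu0 cuE] : c u != 0 /\ `|c u| = e * c u by near: u.
  rewrite normal_pdfE// /normal_peak /normal_fun; congr (_ * expR _).
    rewrite -mulrnAr sqrtrM ?sqr_ge0// sqrtr_sqr cuE -/S.
    have eV : e^-1 = e by rewrite -[LHS]mul1r -e0 expr2 mulfK.
    by rewrite !invfM eV; ring.
  by field.
apply: (near_eq_is_derive pdfE).
rewrite -(nbhs_singleton pdfE).
have dc1 := is_deriveV1 ct0 cd.
have da1 := is_deriveBx x ad.
have dk (k : R) : is_derive t 1 (fun _ : R => k) 0 by exact: is_derive_cst.
have dE := is_deriveM1 (dk (- 2^-1)) (is_deriveM1 (is_deriveM1 da1 da1) (is_deriveM1 dc1 dc1)).
have dexp := @is_derive1_comp _ expR _ t _ _ (is_derive_expR _) dE.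
apply: (is_derive_eq (is_deriveM1 (is_deriveM1 (dk (e / S)) dc1) dexp)).
rewrite /score_mu /score_s /=.
set E := expR _.
by field; rewrite S0 ct0.
Unshelve. all: by end_near. Qed.

(** With [a'] and [c'] the derivatives of [a] and [c], this is the second derivative of the
    log-density along the curve. *)
Lemma is_derive_score a c t x a' c' da dc d2a d2c : c t != 0 ->
  is_derive t 1 a da -> is_derive t 1 c dc ->
  is_derive t 1 a' d2a -> is_derive t 1 c' d2c ->
  is_derive t 1
    (fun u => a' u * score_mu (a u) (c u) x + c' u * score_s (a u) (c u) x)
    (d2a * score_mu (a t) (c t) x + d2c * score_s (a t) (c t) x
     + a' t * (- da / c t ^+ 2 - 2 * (x - a t) * dc / c t ^+ 3)
     + c' t * (- 2 * (x - a t) * da / c t ^+ 3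
               - 3 * (x - a t) ^+ 2 * dc / c t ^+ 4 + dc / c t ^+ 2)).
Proof.
move=> ct0 ad cd ad' cd'.
have dc1 := is_deriveV1 ct0 cd.
have da1 := is_deriveBx x ad.
have dk (k : R) : is_derive t 1 (fun _ : R => k) 0 by exact: is_derive_cst.
have scE : (fun u => a' u * score_mu (a u) (c u) x + c' u * score_s (a u) (c u) x) =
  (fun u => a' u * ((x - a u) * ((c u)^-1 * (c u)^-1)) +
    c' u * ((x - a u) * (x - a u) * ((c u)^-1 * ((c u)^-1 * (c u)^-1)) + (-1) * (c u)^-1)).
  apply/funext => u; rewrite /score_mu /score_s.
  by rewrite -!exprVn !exprS !expr0 !mulr1 mulN1r.
rewrite scE.
have d1 := is_deriveM1 da1 (is_deriveM1 dc1 dc1).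
have d2 := is_deriveD1 (is_deriveM1 (is_deriveM1 da1 da1) (is_deriveM1 dc1 (is_deriveM1 dc1 dc1)))
  (is_deriveM1 (dk (-1)) dc1).
apply: (is_derive_eq (is_deriveD1 (is_deriveM1 ad' d1) (is_deriveM1 cd' d2))).
rewrite /score_mu /score_s /=.
by field; rewrite ct0.
Qed.

(** The neighbourhood does not depend on [x], so the first derivative is available there at all
    points of the Lebesgue integral at once. *)
Lemma near_is_derive_normal_pdf a c t : c t != 0 ->
  derivable2 a t -> derivable2 c t ->
  \forall u \near t, [/\ c u != 0, derivable a u 1, derivable c u 1 &
   forall x, is_derive u 1 (fun u => normal_pdf (a u) (c u) x)
    (normal_pdf (a u) (c u) x *
     (a^`()%classic u * score_mu (a u) (c u) x +
      c^`()%classic u * score_s (a u) (c u) x))].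
Proof.
move=> ct0 [da _] [dc _].
have cc : {for t, continuous c}.
  by apply/differentiable_continuous/derivable1_diffP; exact: nbhs_singleton dc.
have cn0 : \forall u \near t, c u != 0 by exact: (cvgr_neq0 _ cc).
apply: filterS3 cn0 da dc => u cu0 dau dcu.
split; [exact: cu0|exact: dau|exact: dcu|move=> x].
exact: (@is_derive_normal_pdf a c u x _ _ cu0
  (derivable_is_derive1 dau) (derivable_is_derive1 dcu)).
Qed.

(* z stands for the standardized variable (x - a t) / c t. *)
Lemma is_derive2_normal_pdf a c t z : c t != 0 ->
  derivable2 a t -> derivable2 c t ->
  let x := a t + c t * z in
  let da := a^`()%classic t in let dc := c^`()%classic t in
  let d2a := a^`(2)%classic t in let d2c := c^`(2)%classic t in
  is_derive t 1 (fun u => normal_pdf (a u) (c u) x)^`()%classic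
    (normal_pdf (a t) (c t) x *
     (d2a * (z / c t) + da ^+ 2 * ((z ^+ 2 - 1) / c t ^+ 2) +
      dc ^+ 2 * ((z ^+ 4 - 5 * z ^+ 2 + 2) / c t ^+ 2) +
      d2c * ((z ^+ 2 - 1) / c t) +
      2 * da * dc * ((z ^+ 3 - 3 * z) / c t ^+ 2))).
Proof.
move=> ct0 ha hc x da dc d2a d2c.
have nd := near_is_derive_normal_pdf ct0 ha hc.
have [_ dat dct dpt] := nbhs_singleton nd.
have nE : \forall u \near t, normal_pdf (a u) (c u) x *
     (a^`()%classic u * score_mu (a u) (c u) x +
      c^`()%classic u * score_s (a u) (c u) x) =
    (fun u => normal_pdf (a u) (c u) x)^`()%classic u.
  apply: filterS nd => u [_ _ _ dp].
  by have [_ ->] := is_derive1_derivable (dp x).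
apply: (near_eq_is_derive nE).
(* The weights come from p''/p = (ln p)'^2 + (ln p)'', where dz = -(da + z dc)/c at fixed [x]. Up to
   the factor 1/c^2, [dc ^+ 2] receives (z^2 - 1)^2 + 1 - 3 z^2 = z^4 - 5 z^2 + 2, [da ^+ 2]
   receives z^2 - 1, and [2 * da * dc] receives z (z^2 - 1) - 2 z = z^3 - 3 z. *)
have := is_derive_score x ct0 (derivable_is_derive1 dat) (derivable_is_derive1 dct)
  (derivable_is_derive1 ha.2) (derivable_is_derive1 hc.2).
move=> /(is_deriveM1 (dpt x)) H.
apply: (is_derive_eq H).
rewrite /score_mu /score_s.
rewrite -/da -/dc.
rewrite -[a^`()^`()%classic t]/d2a -[c^`()^`()%classic t]/d2c.
have -> : x - a t = c t * z by rewrite /x addrAC subrr add0r.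
by field; rewrite ct0.
Qed.

End pointwise_derivatives.

(** * Differentiating the inner Gaussian expectation *)

Section gauss_expectation_derivatives.
Context (R : realType).
Local Notation leb := (@lebesgue_measure R).
Variables (V : R -> R) (a c : R -> R) (t : R).
Hypothesis mV : measurable_fun [set: R] V.
Hypotheses (ha : derivable2 a t) (hc : derivable2 c t) (ct0 : c t != 0).
Hypothesis hw : gauss_weights_integrable V (a t) (c t).

Let f (u x : R) := V x * normal_pdf (a u) (c u) x.
Hypothesis hui : unif_integrable_diff_quotients2 leb f t.

Let N := @normal_prob R 0 1.
Let int w := N.-integrable [set: R] (EFin \o (fun z => V (a t + c t * z) * w z)).

Let g u := gauss_expectation (fun z => V (a u + c u * z)).

Let mVac : measurable_fun [set: R] (fun z => V (a t + c t * z)).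
Proof.
by apply: (measurableT_comp mV); apply: measurable_funD => //; exact: measurable_funM.
Qed.

(* V itself is integrable as |z| + |z^2 - 1| is bounded away from 0. *)
Let iV : N.-integrable [set: R] (EFin \o (fun z => V (a t + c t * z))).
Proof.
have [i1 i2 _ _] := hw.
have i12 := integrableD measurableT (integrable_abse i1) (integrable_abse i2).
(* The factor 2 suffices for a lower bound 1: either |z| is at least 1/2, or z^2 is at most 1/4 and
   |z^2 - 1| is at least 3/4. *)
have := integrableZl measurableT 2 i12.
apply: le_integrable => //; first exact/measurable_EFinP.
move=> z _ /=; rewrite lee_fin [leRHS]ger0_norm ?mulr_ge0 ?addr_ge0//.
rewrite !normrM -mulrDr mulrCA -[leLHS]mulr1 ler_wpM2l//.
have [z1|z1] := leP 1 (2 * `|z|).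
  by rewrite mulrDr (le_trans z1)// lerDl mulr_ge0.
have z2 : `|z| ^+ 2 <= 4^-1.
  have := normr_ge0 z; nra.
rewrite real_normK ?num_real// in z2.
have : 1 - z ^+ 2 <= `|z ^+ 2 - 1| by rewrite distrC ler_norm.
have := normr_ge0 z; lra.
Qed.

Let mf u : measurable_fun [set: R] (f u).
Proof. by apply: measurable_funM => //; exact: measurable_normal_pdf. Qed.

Let ift : ae_integrable leb (f t).
Proof. by apply: integrable_ae_integrable; exact: integrable_normal_affine. Qed.

Let nd := near_is_derive_normal_pdf ct0 ha hc.

Let is_derive_f (u x : R) : is_derive u 1 (fun v : R => normal_pdf (a v) (c v) x)
    (normal_pdf (a u) (c u) x *
     (a^`()%classic u * score_mu (a u) (c u) x +
      c^`()%classic u * score_s (a u) (c u) x)) ->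
  is_derive u 1 (f ^~ x) (V x * (normal_pdf (a u) (c u) x *
     (a^`()%classic u * score_mu (a u) (c u) x +
      c^`()%classic u * score_s (a u) (c u) x))).
Proof. by move=> fd; apply: (is_derive_eq (is_deriveZ (V x) fd)). Qed.

Let f1 u x := (f ^~ x)^`()%classic u.
Let F u := \int[leb]_x f u x.
Let F1 u := \int[leb]_x f1 u x.

(** The first interchange is carried out on a whole neighbourhood, as [F1] is differentiated
    next. *)
Let near_f : \forall u \near t,
  [/\ derivable F u 1, F^`()%classic u = F1 u & ae_integrable leb (f1 u)].
Proof.
have ui := hui.1.
have mfn (v : R) : \forall u \near v, ae_measurable leb (f u).
  by near=> u; apply: measurable_ae_measurable; exact: mf.
have i_f : \forall u \near t, ae_integrable leb (f u).
  exact: near_ae_integrable ift (mfn t) (nbhs_singleton ui).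
apply: filterS3 nd ui i_f => u [_ _ _ fd] uiu iu.
apply: (derivable_Rintegral iu (mfn u) _ uiu).
by apply: aeW => x; have [] := is_derive_f (fd x).
Unshelve. all: by end_near. Qed.

Let FgE : \forall u \near t, F u = g u.
Proof.
apply: filterS nd => u [cu0 _ _ _].
by rewrite /F /g /gauss_expectation /Rintegral -(integral_normal_affine _ cu0).
Qed.

Let weight (z : R) : R :=
  a^`(2)%classic t * (z / c t) + a^`()%classic t ^+ 2 * ((z ^+ 2 - 1) / c t ^+ 2) +
      c^`()%classic t ^+ 2 * ((z ^+ 4 - 5 * z ^+ 2 + 2) / c t ^+ 2) +
      c^`(2)%classic t * ((z ^+ 2 - 1) / c t) +
      2 * a^`()%classic t * c^`()%classic t * ((z ^+ 3 - 3 * z) / c t ^+ 2).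

Let measurable_weight : measurable_fun [set: R] weight.
Proof.
have mX k : measurable_fun [set: R] (fun z : R => z ^+ k) by exact: measurable_funX.
by rewrite /weight; repeat first [done | exact: mX | apply: measurable_funB
  | apply: measurable_funD | apply: measurable_funM].
Qed.

Let is_derive_f1 (z : R) : let x := a t + c t * z in
  is_derive t 1 (f1 ^~ x) (V x * normal_pdf (a t) (c t) x * weight z).
Proof.
move=> x; have d2 := is_derive2_normal_pdf z ct0 ha hc.
have H := is_deriveZ (V x) d2; rewrite -mulrA.
have fE : \forall u \near t,
    V x *: (fun u => normal_pdf (a u) (c u) x)^`()%classic u = f1 u x.
  apply: filterS nd => u [_ _ _ fd].
  rewrite /f1; have [_ ->] := is_derive1_derivable (fd x).
  by have [_ ->] := is_derive1_derivable (is_derive_f (fd x)).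
exact: (near_eq_is_derive fE).
Qed.

Lemma derivable2_gauss_expectation :
  [/\ derivable g t 1, derivable g^`()%classic t 1 &
   g^`(2)%classic t = gauss_expectation (fun z => V (a t + c t * z) * weight z)].
Proof.
have [F'd F'E if1] := nbhs_singleton near_f.
have df1 x : derivable (f1 ^~ x) t 1 /\ (f1 ^~ x)^`()%classic t =
    V x * weight ((x - a t) / c t) * normal_pdf (a t) (c t) x.
  have := is_derive_f1 ((x - a t) / c t).
  (* Since [c t] is nonzero, every [x] is the image of its standardized value, so [is_derive_f1]
     covers the whole line. *)
  have -> : a t + c t * ((x - a t) / c t) = x by field.
  by move=> /is_derive1_derivable; rewrite mulrAC.
have [dF1 F1E _] : [/\ derivable F1 t 1,
   F1^`()%classic t = \int[leb]_x (f1 ^~ x)^`()%classic t &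
   ae_integrable leb (fun x => (f1 ^~ x)^`()%classic t)].
  apply: derivable_Rintegral => //; last exact: hui.2.
  - by apply: filterS near_f => u [_ _]; exact: ae_integrable_measurable.
  - by apply: aeW => x; have [] := df1 x.
have F1g : \forall u \near t, F1 u = g^`()%classic u.
  by apply: filterS2 near_f (near_eq_derive1 FgE) => u [_ -> _].
split.
- exact: near_eq_derivable FgE F'd.
- exact: near_eq_derivable F1g dF1.
have -> : g^`(2)%classic t = F1^`()%classic t.
  by rewrite (nbhs_singleton (near_eq_derive1 F1g)).
rewrite F1E /gauss_expectation.
under eq_Rintegral do rewrite (df1 _).2.
rewrite /Rintegral (@integral_normal_affine _ (a t) (c t)
  (fun x => V x * weight ((x - a t) / c t)))//; last first.
  apply: measurable_funM => //; apply: (measurableT_comp measurable_weight).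
  by apply: measurable_funM => //; exact: measurable_funB.
congr fine; apply: eq_integral => z _; congr (_ * weight _)%:E.
by field.
Qed.

(** Linearity is used term by term, so each weighted payoff must be integrable on its own; the
    weight z^2 - 1 serves two of the five terms. *)
Lemma gauss_weights_expectation :
  gauss_expectation (fun z => V (a t + c t * z) * weight z) =
  (let EZ (w : R -> R) :=
     gauss_expectation (fun z => V (a t + c t * z) * w z) in
   let da := a^`()%classic t in
   let dc := c^`()%classic t in
   let d2a := a^`(2)%classic t in
   let d2c := c^`(2)%classic t in
   let s := c t in
   d2a * EZ (fun z => z / s)
   + da ^+ 2 * EZ (fun z => (z ^+ 2 - 1) / s ^+ 2)
   + dc ^+ 2 * EZ (fun z => (z ^+ 4 - 5 * z ^+ 2 + 2) / s ^+ 2)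
   + d2c * EZ (fun z => (z ^+ 2 - 1) / s)
   + 2 * da * dc * EZ (fun z => (z ^+ 3 - 3 * z) / s ^+ 2)).
Proof.
have [i1 i2 i3 i4] := hw.
have divr w k : int w -> int (fun z => w z / k).
  move=> iw; apply: eq_integrable (integrableZl measurableT k^-1 iw) => // z _.
  by rewrite /= -EFinM; congr EFin; ring.
have scale w k : int w -> int (fun z => k * w z).
  move=> iw; apply: eq_integrable (integrableZl measurableT k iw) => // z _.
  by rewrite /= -EFinM; congr EFin; ring.
have add w w' : int w -> int w' -> int (fun z => w z + w' z).
  move=> iw iw'; apply: eq_integrable (integrableD measurableT iw iw') => // z _.
  by rewrite /= -EFinD mulrDr.
have Eadd w w' : int w -> int w' ->
    gauss_expectation (fun z => V (a t + c t * z) * (w z + w' z)) =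
    gauss_expectation (fun z => V (a t + c t * z) * w z) +
    gauss_expectation (fun z => V (a t + c t * z) * w' z).
  move=> iw iw'; rewrite /gauss_expectation -RintegralD//.
  by apply: eq_Rintegral => z _; rewrite mulrDr.
have Escale w k : int w ->
    gauss_expectation (fun z => V (a t + c t * z) * (k * w z)) =
    k * gauss_expectation (fun z => V (a t + c t * z) * w z).
  move=> iw; rewrite /gauss_expectation -RintegralZl//.
  by apply: eq_Rintegral => z _; rewrite mulrCA.
have j1 := divr _ (c t) i1; have j2 := divr _ (c t ^+ 2) i2.
have j3 := divr _ (c t ^+ 2) i4; have j4 := divr _ (c t) i2.
have j5 := divr _ (c t ^+ 2) i3.
have k2 := add _ _ (scale _ (a^`(2)%classic t) j1) (scale _ (a^`()%classic t ^+ 2) j2).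
have k3 := add _ _ k2 (scale _ (c^`()%classic t ^+ 2) j3).
have k4 := add _ _ k3 (scale _ (c^`(2)%classic t) j4).
have k5 := scale _ (2 * a^`()%classic t * c^`()%classic t) j5.
rewrite /weight (Eadd _ _ k4 k5) (Eadd _ _ k3 (scale _ _ j4)).
rewrite (Eadd _ _ k2 (scale _ _ j3)) (Eadd _ _ (scale _ _ j1) (scale _ _ j2)).
by rewrite (Escale _ _ j1) (Escale _ _ j2) (Escale _ _ j3) (Escale _ _ j4) (Escale _ _ j5).
Qed.

End gauss_expectation_derivatives.

(** * The second derivative of the expected payoff *)

Theorem theorem2p6 (R : realType) (d : measure_display)
    (Omega : measurableType d) (P : probability Omega R)
    (Theta : set R) (b sigma : R -> R -> R) (X0 : R -> R)
    (T : R) (n : nat) (Z : nat -> {RV P >-> R}) (V : R -> R)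
    (T_gt0 : 0 < T) (n_gt0 : (0 < n)%N)
    (b_cont : jointly_continuous Theta b)
    (b_lip : locally_lipschitz_unif Theta b)
    (b_growth : linear_growth_unif Theta b)
    (sigma_cont : jointly_continuous Theta sigma)
    (sigma_lip : locally_lipschitz_unif Theta sigma)
    (sigma_growth : linear_growth_unif Theta sigma)
    (Z_normal : forall k : nat, (0 < k <= n)%N ->
       forall A : set R, measurable A ->
         distribution P (Z k) A = normal_prob (0 : R) 1 A)
    (Z_indep : mutually_independent P [set k : nat | (0 < k <= n)%N]
                 (fun k => Z k : Omega -> R))
    (V_borel : measurable_fun [set: R] V) :
  let h := T / n%:R in
  let X (theta : R) (w : Omega) :=
    euler b sigma X0 h theta (fun k => Z k w) n in
  let mu (theta : R) (w : Omega) :=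
    euler_mu b sigma X0 h n theta (fun k => Z k w) in
  let s (theta : R) (w : Omega) :=
    euler_s b sigma X0 h n theta (fun k => Z k w) in
  let EV (theta : R) := fine ('E_P[fun w => V (X theta w)])%E in
  (* integrability of the payoff *)
  (forall theta, Theta theta ->
     ('E_P[fun w => (`|V (X theta w)|)%R] < +oo)%E) ->
  (* the derivatives, quotients and expectations of the formula make sense *)
  (forall theta, Theta° theta ->
     {ae P, forall w,
        [/\ derivable2 (mu ^~ w) theta, derivable2 (s ^~ w) theta,
            s theta w != 0 &
            gauss_weights_integrable V (mu theta w) (s theta w)]}) ->
  (* interchange of d/dtheta with E_Z, written with the density of mu + s Z *)
  (forall theta, Theta° theta ->
     {ae P, forall w,
        unif_integrable_diff_quotients2 (@lebesgue_measure R)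
          (fun t x => V x * normal_pdf (mu t w) (s t w) x) theta}) ->
  (* interchange of d/dtheta with the outer expectation *)
  (forall theta, Theta° theta ->
     unif_integrable_diff_quotients2 P
       (fun t w => gauss_expectation (fun z => V (mu t w + s t w * z)))
       theta) ->
  forall theta, Theta° theta ->
    derivable2 EV theta /\
    ((EV^`(2)%classic theta)%:E = 'E_P[fun w =>
      (let EZ (weight : R -> R) :=
         gauss_expectation (fun z =>
           V (mu theta w + s theta w * z) * weight z) in
       let dmu := (mu ^~ w)^`()%classic theta in
       let ds := (s ^~ w)^`()%classic theta in
       let d2mu := (mu ^~ w)^`(2)%classic theta in
       let d2s := (s ^~ w)^`(2)%classic theta in
       let sw := s theta w in
       d2mu * EZ (fun z => z / sw)
       + dmu ^+ 2 * EZ (fun z => (z ^+ 2 - 1) / sw ^+ 2)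
       + ds ^+ 2 * EZ (fun z => (z ^+ 4 - 5 * z ^+ 2 + 2) / sw ^+ 2)
       + d2s * EZ (fun z => (z ^+ 2 - 1) / sw)
       + 2 * dmu * ds * EZ (fun z => (z ^+ 3 - 3 * z) / sw ^+ 2))%R])%E.
Proof.
move=> h X mu s EV V_int sense ui_in ui_out theta Theta_theta.
pose G (t : R) (w : Omega) := gauss_expectation (fun z => V (mu t w + s t w * z)).
pose dG (t : R) (w : Omega) := (G ^~ w)^`()%classic t.
(* The interior of [Theta] is open, so the hypotheses remain available at all parameters near
   [theta]. *)
have nearTheta (t : R) : Theta° t -> \forall u \near t, Theta° u.
  by move=> Tt; apply: open_nbhs_nbhs; split => //; exact: open_interior.
have EVG t : Theta t -> P.-integrable [set: Omega] (EFin \o G t) /\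
    EV t = \int[P]_w G t w.
  move=> Tt; have [iG EVE] := expectation_euler b_cont sigma_cont (X0 := X0) (h := h)
    n_gt0 Z_normal Z_indep V_borel Tt (V_int t Tt).
  by split => //; rewrite /EV EVE.
have iG t : Theta° t -> ae_integrable P (G t).
  by move=> /interior_subset /EVG[iG _]; exact: integrable_ae_integrable.
have mG t : Theta° t -> \forall u \near t, ae_measurable P (G u).
  by move=> /nearTheta; apply: filterS => u /iG/ae_integrable_measurable.
(* The first conclusion feeds the first outer interchange at every [t] near [theta]; the second
   feeds the second interchange, at [theta] only. *)
have inner t : Theta° t -> {ae P, forall w,
    [/\ derivable (G ^~ w) t 1, derivable (G ^~ w)^`()%classic t 1 &
     (G ^~ w)^`(2)%classic t =
      (let EZ (weight : R -> R) :=
         gauss_expectation (fun z => V (mu t w + s t w * z) * weight z) in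
       let dmu := (mu ^~ w)^`()%classic t in
       let ds := (s ^~ w)^`()%classic t in
       let d2mu := (mu ^~ w)^`(2)%classic t in
       let d2s := (s ^~ w)^`(2)%classic t in
       let sw := s t w in
       d2mu * EZ (fun z => z / sw)
       + dmu ^+ 2 * EZ (fun z => (z ^+ 2 - 1) / sw ^+ 2)
       + ds ^+ 2 * EZ (fun z => (z ^+ 4 - 5 * z ^+ 2 + 2) / sw ^+ 2)
       + d2s * EZ (fun z => (z ^+ 2 - 1) / sw)
       + 2 * dmu * ds * EZ (fun z => (z ^+ 3 - 3 * z) / sw ^+ 2))]}.
  move=> Tt; apply: filterS2 (sense t Tt) (ui_in t Tt) => w [hmu hs s0 hw] hui.
  have [d1 d2 dE] := derivable2_gauss_expectation V_borel hmu hs s0 hw hui.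
  split; [exact: d1|exact: d2|].
  exact: etrans dE (@gauss_weights_expectation R V (mu ^~ w) (s ^~ w) t hw).
have near_dEV : \forall u \near theta,
    [/\ derivable EV u 1, EV^`()%classic u = \int[P]_w dG u w &
     ae_integrable P (dG u)].
  apply: filterS2 (nearTheta _ Theta_theta) (ui_out _ Theta_theta).1 => u Tu ui_u.
  have [dF FE iD] := derivable_Rintegral (iG u Tu) (mG u Tu)
    (filterS (fun w '(And3 d _ _) => d) (inner u Tu)) ui_u.
  have EVE : \forall v \near u, \int[P]_w G v w = EV v.
    by apply: filterS (nearTheta _ Tu) => v /interior_subset /EVG[_ ->].
  split; [exact: near_eq_derivable EVE dF| |exact: iD].
  by rewrite -FE; exact/esym/(nbhs_singleton (near_eq_derive1 EVE)).
have [dEV _ idG] := nbhs_singleton near_dEV.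
have [dF FE iD] := derivable_Rintegral idG
  (filterS (fun u '(And3 _ _ i) => ae_integrable_measurable i) near_dEV)
  (filterS (fun w '(And3 _ d _) => d) (inner theta Theta_theta))
  (ui_out _ Theta_theta).2.
have dEVE : \forall u \near theta, \int[P]_w dG u w = EV^`()%classic u.
  by apply: filterS near_dEV => u [_ -> _].
split; first split.
- by apply: filterS near_dEV => u [dEVu _ _]; exact: dEVu.
- exact: near_eq_derivable dEVE dF.
have -> : EV^`(2)%classic theta = \int[P]_w (dG ^~ w)^`()%classic theta.
  by rewrite -FE; exact/esym/(nbhs_singleton (near_eq_derive1 dEVE)).
rewrite unlock.
(* The second pathwise derivative may fail to be measurable; its integrable version [D] ensures that
   the extended integral is finite, so that [fine] loses nothing. *)
have [D iD0 DE] := iD.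
have DE' := ae_eq_Rintegral DE.
rewrite DE' /Rintegral fineK; last exact: integrable_fin_num.
apply: ae_eq_integralT; apply: filterS2 DE (inner theta Theta_theta) => w <- [_ _ E2].
by rewrite -E2.
Qed.
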